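(* Let $q \ge 2$ be a prime power, let $b \ge 1$ be an integer and let $c \ge 1$ be a real number. There exists $n_0$ (depending on $q, b, c$) such that for all $n \ge n_0$ the rank-$n$ projective geometry $\mathrm{PG}(n-1,q)$ admits no $(b,c)$-decomposition.
   Context: $\mathrm{PG}(n-1,q)$ denotes the rank-$n$ projective geometry over the finite field $\mathrm{GF}(q)$, regarded as a matroid: its ground set consists of the $\frac{q^n-1}{q-1}$ one-dimensional subspaces (points) of $\mathrm{GF}(q)^n$, and a set of points is independent if nonzero vectors representing its elements are linearly independent over $\mathrm{GF}(q)$. A matroid is $k$-colourable if its ground set can be partitioned into $k$ (possibly empty) independent sets. The colouring number $\mathrm{col}(M)$ is the smallest $k$ such that $M$ is $k$-colourable. A subset $Y$ of the ground set of $M$ is called $b$-colourable if the restriction $M|Y$ is $b$-colourable. A $(b,c)$-decomposition of a matroid $M$ with ground set $E$ and colouring number $k = \mathrm{col}(M)$ is a partition $E = E_1 \cup E_2 \cup \cdots \cup E_\ell$ into nonempty classes (for some number $\ell$) such that (i) $|E_i| \le ck$ for all $i \in \{1,\dots,\ell\}$, and (ii) every transversal $Y = \{y_1,\dots,y_\ell\}$ with $y_i \in E_i$ for all $i$ is $b$-colourable. *)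

(* Defs.v *)
From HB Require Import structures.
From mathcomp Require Import all_boot all_order all_algebra all_field.
From mathcomp Require Import boolp reals.

Set Implicit Arguments.
Unset Strict Implicit.
Unset Printing Implicit Defensive.

Import Order.TTheory GRing.Theory Num.Theory.

(* The ground set is a subset of the carrier type, so that a matroid and its
   restrictions live on the same type. *)
Record matroid (T : finType) := Matroid {
  ground : {set T};
  indep : pred {set T};
  indep_ground : forall X : {set T}, indep X -> X \subset ground;
  indep0 : indep set0;
  indepS : forall X Y : {set T}, X \subset Y -> indep Y -> indep X;
  indep_exch : forall X Y : {set T}, indep X -> indep Y -> #|X| < #|Y| ->
    exists2 y, y \in Y :\: X & indep (y |: X)
}.

Section Restriction.
Variables (T : finType) (M : matroid T) (Y : {set T}).

Definition restr_indep : pred {set T} := fun X => (X \subset Y) && indep M X.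

Fact restr_indep_ground (X : {set T}) : restr_indep X -> X \subset ground M :&: Y.
Proof. by case/andP=> XY iX; rewrite subsetI XY (indep_ground iX). Qed.

Fact restr_indep0 : restr_indep set0.
Proof. by rewrite /restr_indep sub0set indep0. Qed.

Fact restr_indepS (X Z : {set T}) : X \subset Z -> restr_indep Z -> restr_indep X.
Proof.
move=> XZ /andP[ZY iZ].
by rewrite /restr_indep (subset_trans XZ ZY) (indepS XZ iZ).
Qed.

Fact restr_indep_exch (X Z : {set T}) : restr_indep X -> restr_indep Z -> #|X| < #|Z| ->
  exists2 z, z \in Z :\: X & restr_indep (z |: X).
Proof.
move=> /andP[XY iX] /andP[ZY iZ] ltXZ.
have [z zZX izX] := indep_exch iX iZ ltXZ.
exists z => //; rewrite /restr_indep izX subUset sub1set XY !andbT.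
by apply: (subsetP ZY); case/setDP: zZX.
Qed.

Definition restrict : matroid T :=
  Matroid restr_indep_ground restr_indep0 restr_indepS restr_indep_exch.

End Restriction.

Section Colouring.
Variable T : finType.
Implicit Types (M : matroid T) (Y : {set T}).

(* The colour classes S i may be empty. *)
Definition colourable M (k : nat) : bool :=
  [exists S : {ffun 'I_k -> {set T}},
    [&& \bigcup_i S i == ground M,
        [forall i, forall j, (i != j) ==> [disjoint S i & S j]]
      & [forall i, indep M (S i)]]].

Definition set_colourable M Y (k : nat) : bool := colourable (restrict M Y) k.

(* The value 0 is a dummy when M is not k-colourable for any k, i.e. when M
   has a loop; see loopless_colourable. *)
Definition colouring_number M : nat :=
  if pselect (exists k, colourable M k) is left ex_k then ex_minn ex_k else 0.

Lemma colouring_numberP M k : colourable M k ->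
  colourable M (colouring_number M) /\ (forall j, colourable M j -> colouring_number M <= j).
Proof.
move=> Mk; rewrite /colouring_number; case: pselect => [ex_k|[]]; last by exists k.
by case: ex_minnP.
Qed.

Lemma loopless_colourable M :
  (forall x, x \in ground M -> indep M [set x]) -> colourable M #|T|.
Proof.
move=> loopless; pose S (i : 'I_#|T|) := [set x in ground M | x == enum_val i].
apply/existsP; exists [ffun i : 'I_#|T| => S i]; apply/and3P; split.
- apply/eqP/setP=> x; apply/bigcupP/idP=> [[i _]|Ex].
    by rewrite ffunE inE => /andP[].
  by exists (enum_rank x); rewrite // ffunE inE Ex enum_rankK eqxx.
- apply/forallP=> i; apply/forallP=> j; apply/implyP=> neq_ij.
  rewrite !ffunE -setI_eq0; apply/eqP/setP=> x; rewrite !inE.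
  apply/negbTE/negP=> /andP[/andP[_ /eqP->] /andP[_ /eqP/enum_val_inj eq_ij]].
  by rewrite eq_ij eqxx in neq_ij.
apply/forallP=> i; rewrite ffunE.
have [Ei|nEi] := boolP (enum_val i \in ground M).
  apply: indepS (loopless _ Ei); apply/subsetP=> x.
  by rewrite !inE => /andP[].
suff ->: S i = set0 by apply: indep0.
apply/setP=> x; rewrite !inE; apply/negbTE/negP=> /andP[Ex /eqP eq_x].
by rewrite -eq_x Ex in nEi.
Qed.

(* P is the set of classes E_1, ..., E_l; partition excludes empty classes. *)
Definition is_decomposition (R : realType) (b : nat) (c : R) M
    (P : {set {set T}}) : Prop :=
  [/\ partition P (ground M),
      forall A, A \in P -> (#|A|%:R <= c * (colouring_number M)%:R)%R
    & forall Y, is_transversal Y P (ground M) -> set_colourable M Y b].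

Definition has_decomposition (R : realType) (b : nat) (c : R) M : Prop :=
  exists P, is_decomposition b c M P.

End Colouring.

(* VectorInternalTheory provides the subType structure of {vspace _}. *)
Import VectorInternalTheory.
HB.instance Definition _ (F : finFieldType) (n : nat) :=
  [Countable of {vspace 'rV[F]_n} by <:].
HB.instance Definition _ (F : finFieldType) (n : nat) :=
  [Finite of {vspace 'rV[F]_n} by <:].

Section ProjectiveGeometry.
Variables (F : finFieldType) (n : nat).
Local Notation subspace := {vspace 'rV[F]_n}.
Implicit Types (X Y : {set subspace}) (U : subspace).

Definition points : {set subspace} := [set U : subspace | \dim U == 1%N].

(* vpick U is a nonzero vector of U when \dim U = 1; by PG_indepE the choice of
   representatives is irrelevant. *)
Definition PG_indep : pred {set subspace} :=
  fun X => (X \subset points) && free [seq vpick U | U <- enum X].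

Lemma point_vpick U v : U \in points -> v \in U -> v != 0%R -> U = <[v]>%VS.
Proof.
rewrite inE => /eqP dimU Uv nz_v; apply/esym/eqP.
by rewrite eqEdim dimU dim_vline nz_v -memvE Uv.
Qed.

Lemma PG_indepE X (f : subspace -> 'rV[F]_n) :
    X \subset points -> (forall U, U \in X -> f U \in U /\ f U != 0%R) ->
  PG_indep X = free [seq f U | U <- enum X].
Proof.
move=> sXE fP; rewrite /PG_indep sXE /= !free_directv.
have pick0 U : U \in points -> vpick U != 0%R.
  by move=> EU; rewrite vpick0; apply: contraTneq EU => ->; rewrite inE dimv0.
have vl U : U \in enum X -> (<[vpick U]> = <[f U]>)%VS.
  rewrite mem_enum => UX; have EU := subsetP sXE _ UX.
  have [fU nz_f] := fP U UX; rewrite -(point_vpick EU fU nz_f).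
  by rewrite -(point_vpick EU (memv_pick U)) // pick0.
have nz g : (forall U, U \in X -> g U != 0%R) ->
    (0%R : 'rV[F]_n) \notin [seq g U | U <- enum X].
  move=> gP; apply/mapP=> -[U + eq0]; rewrite mem_enum => /gP.
  by rewrite -eq0 eqxx.
rewrite (nz _ (fun U UX => pick0 U (subsetP sXE U UX))).
rewrite (nz _ (fun U UX => proj2 (fP U UX))) /=.
rewrite /directv_def /= !big_map.
have -> : (\sum_(U <- enum X) <[vpick U]> = \sum_(U <- enum X) <[f U]>)%VS.
  by rewrite !big_seq; apply: eq_bigr => U /vl ->.
have -> // : \sum_(U <- enum X) \dim <[vpick U]> =
  \sum_(U <- enum X) \dim <[f U]>.
by rewrite !big_seq; apply: eq_bigr => U /vl ->.
Qed.

Fact PG_indep_ground X : PG_indep X -> X \subset points.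
Proof. by case/andP. Qed.

Fact PG_indep0 : PG_indep set0.
Proof. by rewrite /PG_indep sub0set enum_set0 nil_free. Qed.

Fact PG_indepS X Y : X \subset Y -> PG_indep Y -> PG_indep X.
Proof.
move=> sXY /andP[sYE fY]; rewrite /PG_indep (subset_trans sXY sYE) /=.
have /perm_free-> : perm_eq [seq vpick U | U <- enum X]
    [seq vpick U | U <- [seq U <- enum Y | U \in X]].
  apply/perm_map/uniq_perm=> [||U].
  - exact: enum_uniq.
  - by apply/filter_uniq/enum_uniq.
  by rewrite [RHS]mem_filter !mem_enum andb_idr // => /(subsetP sXY).
have: perm_eq ([seq U <- enum Y | U \in X] ++ [seq U <- enum Y | U \notin X])
   (enum Y) by rewrite perm_filterC.
by move=> /(perm_map (@vpick _ _))/perm_free; rewrite fY map_cat => /catl_free.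
Qed.

Fact PG_indep_exch X Y : PG_indep X -> PG_indep Y -> #|X| < #|Y| ->
  exists2 y, y \in Y :\: X & PG_indep (y |: X).
Proof.
move=> /andP[sXE fX] /andP[sYE fY] ltXY.
pose vs (Z : {set subspace}) := [seq vpick U | U <- enum Z].
have [YX|] := boolP (all (fun v => v \in <<vs X>>%VS) (vs Y)).
  have /dimvS : (<<vs Y>> <= <<vs X>>)%VS by apply/span_subvP=> v; apply: (allP YX).
  by rewrite (eqP fX) (eqP fY) !size_map -!cardE leqNgt ltXY.
case/allPn=> _ /mapP[y + ->] nXy; rewrite mem_enum => Yy.
have nyX : y \notin X.
  by apply: contra nXy => Xy; apply/memv_span/map_f; rewrite mem_enum.
exists y; first by rewrite inE nyX.
rewrite /PG_indep subUset sub1set (subsetP sYE) // sXE /=.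
have /(perm_map (@vpick _ _))/perm_free-> : perm_eq (enum (y |: X)) (y :: enum X).
  apply: uniq_perm; rewrite /= ?mem_enum ?nyX ?enum_uniq // => U.
  by rewrite inE !mem_enum !inE.
by rewrite /= free_cons nXy.
Qed.

Definition PG : matroid subspace :=
  Matroid PG_indep_ground PG_indep0 PG_indepS PG_indep_exch.

Lemma PG_loopless U : U \in ground PG -> indep PG [set U].
Proof.
move=> EU; rewrite /indep /= /PG_indep sub1set EU enum_set1 /= seq1_free vpick0.
by apply: contraTneq EU => ->; rewrite inE dimv0.
Qed.

End ProjectiveGeometry.

Definition prime_power (q : nat) : Prop :=
  exists p k : nat, [/\ prime p, 0 < k & q = p ^ k].

(* Main.v *)
(* Greedily removing independent m-sets shows that the colouring number k of
   PG(n-1,q) satisfies m k <= q^n + m q^m for every m, so that k = o(q^n): each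
   class contains a vanishing proportion of the points. For a uniformly random
   (a, B) and y <> y', the vectors a + y B and a + y' B are independent and
   uniform, hence almost never lie in the same class; for n large
   some (a, B) puts all of the nonzero vectors a + y B, with y in GF(q)^d, in
   different classes. A transversal through these q^d - 1 or more points, which
   have rank at most d + 1, cannot be covered by b independent sets as soon as
   q^d - 1 > b (d + 1). *)
Require Import Defs.
From mathcomp Require Import all_boot all_order all_algebra all_field.
From mathcomp Require Import reals.
From mathcomp Require Import zify.

Set Implicit Arguments.
Unset Strict Implicit.
Unset Printing Implicit Defensive.

Import Order.TTheory GRing.Theory Num.Theory.

(** * Greedy colourings of a matroid *)

Lemma colourable_fun (T : finType) (M : matroid T) (k : nat) (f : T -> nat) :
    {in ground M, forall x, f x < k} ->
    (forall i, indep M [set x in ground M | f x == i]) ->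
  colourable M k.
Proof.
move=> f_lt f_indep.
apply/existsP; exists [ffun i : 'I_k => [set x in ground M | f x == i]].
apply/and3P; split.
- apply/eqP/setP=> x; apply/bigcupP/idP=> [[i _]|Mx].
    by rewrite ffunE inE => /andP[].
  by exists (Ordinal (f_lt x Mx)); rewrite // ffunE inE Mx /= eqxx.
- apply/forallP=> i; apply/forallP=> j; apply/implyP=> neq_ij.
  rewrite !ffunE; apply/pred0P=> x /=; rewrite !inE.
  apply: contraNF neq_ij => /andP[/andP[_ /eqP fxi] /andP[_ /eqP fxj]].
  by apply/eqP/val_inj; rewrite /= -fxi.
by apply/forallP=> i; rewrite ffunE.
Qed.

(** Each independent [m]-set removed uses one colour and [m] elements. Once none is left, at most
    [r] elements remain, and each of them receives a colour of its own. *)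
Lemma greedy_colouring (T : finType) (M : matroid T) (m r : nat) : 0 < m ->
    (forall x, x \in ground M -> indep M [set x]) ->
    (forall X : {set T}, X \subset ground M ->
      (forall I : {set T}, I \subset X -> indep M I -> #|I| != m) -> #|X| <= r) ->
  exists2 k, colourable M k & m * k <= #|ground M| + m * r.
Proof.
move=> m_gt0 loopless smallX.
suff greedy s (X : {set T}) : #|X| <= s -> X \subset ground M ->
    exists2 k, m * k <= #|X| + m * r & exists2 f : T -> nat,
      {in X, forall x, f x < k} & forall i, indep M [set x in X | f x == i].
  have [k le_k [f f_lt f_indep]] := greedy _ (ground M) (leqnn _) (subxx _).
  by exists k => //; apply: colourable_fun f_lt f_indep.
elim: s X => [|s IHs] X leXs sXM.
  have X0 : X = set0 by apply/eqP; rewrite -cards_eq0 -leqn0.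
  exists 0; first by rewrite muln0.
  exists (fun=> 0) => [x|i]; first by rewrite X0 inE.
  by apply: indepS (indep0 M); apply/subsetP=> x; rewrite X0 !inE.
have [/existsP[I /and3P[sIX iI /eqP cardI]]|noI] :=
    boolP [exists I : {set T}, [&& I \subset X, indep M I & #|I| == m]].
  have cardD : #|X :\: I| = #|X| - m by rewrite cardsD (setIidPr sIX) cardI.
  have leIX : m <= #|X| by rewrite -cardI subset_leq_card.
  have [||k le_k [f f_lt f_indep]] := IHs (X :\: I).
  - by rewrite cardD; lia.
  - exact: subset_trans (subsetDl _ _) sXM.
  exists k.+1; first by rewrite mulnS; lia.
  exists (fun x => if x \in I then k else f x) => [x Xx|i].
    case: ifPn => [|nIx]; first by rewrite ltnS.
    by rewrite ltnS ltnW // f_lt // inE nIx.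
  have [->|neq_ik] := eqVneq i k.
    apply: indepS iI; apply/subsetP=> x; rewrite inE => /andP[Xx].
    case: ifPn => // nIx /eqP fx; have := f_lt x.
    by rewrite inE nIx Xx fx ltnn => /(_ isT).
  apply: indepS (f_indep i); apply/subsetP=> x; rewrite !inE => /andP[-> ].
  by case: ifP => // _; rewrite eq_sym (negPf neq_ik).
(* No independent [m]-set is left in [X]: every element is coloured by its position in [enum X], so
   colour classes have at most one element. *)
exists #|X|.
  have : #|X| <= r.
    apply: smallX => // I sIX iI; apply: contraNneq noI => cardI.
    by apply/existsP; exists I; rewrite sIX iI cardI eqxx.
  by move/(leq_mul (leqnn m)); lia.
exists (fun x => index x (enum X)) => [x Xx|i].
  by rewrite cardE index_mem mem_enum.
have [->|[x Mx sub]] : [set x in X | index x (enum X) == i] = set0 \/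
    exists2 x, x \in ground M &
      [set x in X | index x (enum X) == i] \subset [set x].
- have [->|[x]] := set_0Vmem [set x in X | index x (enum X) == i]; first by left.
  rewrite inE => /andP[Xx /eqP ix]; right; exists x; first exact: (subsetP sXM).
  apply/subsetP=> y; rewrite !inE => /andP[Xy /eqP iy]; apply/eqP.
  by rewrite -[y](nth_index x (s := enum X)) ?mem_enum // iy -ix nth_index ?mem_enum.
- exact: indep0.
exact: indepS sub (loopless x Mx).
Qed.

(** * Points, spans and independent sets in projective geometries *)

Lemma PG_indep_setU1 (F : finFieldType) (n : nat) (X : {set {vspace 'rV[F]_n}}) U :
    PG_indep X -> U \in points F n ->
    vpick U \notin <<[seq vpick V | V <- enum X]>>%VS ->
  (U \notin X) && PG_indep (U |: X).
Proof.
move=> /andP[sXE fX] EU nXU.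
have nX : U \notin X.
  by apply: contra nXU => XU; apply/memv_span/map_f; rewrite mem_enum.
rewrite nX /PG_indep subUset sub1set EU sXE /=.
have /(perm_map (@vpick _ _))/perm_free-> : perm_eq (enum (U |: X)) (U :: enum X).
  apply: uniq_perm; rewrite /= ?mem_enum ?nX ?enum_uniq // => V.
  by rewrite inE !mem_enum !inE.
by rewrite /= free_cons nXU.
Qed.

Lemma points_vline (F : finFieldType) (n : nat) U :
  U \in points F n -> (<[vpick U]>)%VS = U.
Proof.
move=> EU; apply/esym/(point_vpick EU (memv_pick U)).
by rewrite vpick0; apply: contraTneq EU => ->; rewrite inE dimv0.
Qed.

Lemma vline_points (F : finFieldType) (n : nat) (v : 'rV[F]_n) :
  (<[v]>%VS \in points F n) = (v != 0%R).
Proof. by rewrite inE dim_vline eqb1. Qed.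

(** Distinct points have distinct representatives [vpick], so counting the vectors of [W] gives a
    crude bound on the points. *)
Lemma card_points_subset (F : finFieldType) (n : nat) (X : {set {vspace 'rV[F]_n}})
    (W : {vspace 'rV[F]_n}) :
    X \subset points F n -> (forall U, U \in X -> vpick U \in W) ->
  #|X| <= #|F| ^ \dim W.
Proof.
move=> sXE XW; rewrite -card_vspace -(card_in_imset (f := @vpick _ _) (D := X)).
  by apply/subset_leq_card/subsetP=> _ /imsetP[U XU ->]; apply: XW.
move=> U V XU XV eqUV.
by rewrite -(points_vline (subsetP sXE _ XU)) eqUV points_vline // (subsetP sXE).
Qed.

(** An independent subset of fewer than [m] points spans fewer than [q^m] vectors, where [q = #|F|].
    If [X] has more than [q^m] points, one of them lies outside the span and extends the subset.
    This bounds the remainder in the greedy colouring. *)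
Lemma PG_indep_exists (F : finFieldType) (n m : nat) (X : {set {vspace 'rV[F]_n}}) :
    X \subset points F n ->
    (forall I : {set {vspace 'rV[F]_n}}, I \subset X -> PG_indep I -> #|I| != m) ->
  #|X| <= #|F| ^ m.
Proof.
move=> sXE noI; rewrite leqNgt; apply/negP=> ltX.
suff [I sIX [iI cardI]] : exists2 I : {set {vspace 'rV[F]_n}},
    I \subset X & PG_indep I /\ #|I| = m.
  by have := noI I sIX iI; rewrite cardI eqxx.
have: m <= m by [].
elim: {-2}m => [|j IHj] lt_jm.
  by exists set0; rewrite ?sub0set ?PG_indep0 ?cards0.
have [I sIX [iI cardI]] := IHj (ltnW lt_jm).
pose W := <<[seq vpick V | V <- enum I]>>%VS.
have [XW|] := boolP [forall U in X, vpick U \in W].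
  have leXW := card_points_subset sXE (forall_inP XW).
  have leW : \dim W <= m.
    by apply: leq_trans (dim_span _) _; rewrite size_map -cardE cardI ltnW.
  have /ltn_geF/negbT/negP[] := ltX; apply: leq_trans leXW _.
  by rewrite leq_pexp2l // ltnW // finNzRing_gt1.
case/forall_inPn=> U XU nWU.
have /andP[nIU iUI] := PG_indep_setU1 iI (subsetP sXE _ XU) nWU.
exists (U |: I); first by rewrite subUset sub1set XU.
by split=> //; rewrite cardsU1 nIU cardI.
Qed.

Lemma PG_indep_card (F : finFieldType) (n : nat) (X : {set {vspace 'rV[F]_n}})
    (W : {vspace 'rV[F]_n}) :
  PG_indep X -> (forall U, U \in X -> (U <= W)%VS) -> #|X| <= \dim W.
Proof.
case/andP=> _ fX XW; rewrite cardE -(size_map (@vpick _ _)) -(eqP fX).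
apply/dimvS/span_subvP=> _ /mapP[U + ->]; rewrite mem_enum => /XW/subvP.
by apply; apply: memv_pick.
Qed.

(** Each of the [b] colour classes meets [Z] in an independent set inside [W], hence in at most
    [\dim W] points. *)
Lemma PG_colourable_card (F : finFieldType) (n b : nat)
    (Y Z : {set {vspace 'rV[F]_n}}) (W : {vspace 'rV[F]_n}) :
    set_colourable (PG F n) Y b -> Z \subset Y -> Z \subset points F n ->
    (forall U, U \in Z -> (U <= W)%VS) ->
  #|Z| <= b * \dim W.
Proof.
case/existsP=> S /and3P[/eqP coverS _ /forallP iS] sZY sZE ZW.
have sZS : Z \subset \bigcup_i (S i :&: Z).
  apply/subsetP=> U ZU; have : U \in \bigcup_i S i.
    by rewrite coverS /= inE (subsetP sZE) ?(subsetP sZY).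
  by case/bigcupP=> i _ SU; apply/bigcupP; exists i => //; rewrite inE SU.
apply: leq_trans (subset_leq_card sZS) _.
apply: (@leq_trans (\sum_(i < b) #|S i :&: Z|)).
  elim/big_ind2: _ => [|A m B l leA leB|i _]; rewrite ?cards0 //.
  by apply: leq_trans (leq_card_setU _ _) _; apply: leq_add.
rewrite -[b in b * _]card_ord -sum_nat_const; apply: leq_sum => i _.
apply: PG_indep_card => [|U /setIP[_ /ZW] //].
by case/andP: (iS i) => _; apply: indepS (subsetIl _ _).
Qed.

(** * Completing a partial transversal *)

Lemma transversal_extend (T : finType) (P : {set {set T}}) (D Z : {set T}) :
    partition P D -> Z \subset D -> {in Z &, injective (pblock P)} ->
  exists2 Y, is_transversal Y P D & Z \subset Y.
Proof.
move=> partP sZD injZ; have /and3P[/eqP coverP trivP nP0] := partP.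
(* The representative of a block is taken in [Z] whenever the block meets [Z]. The sum type is
   informative, so that [Y] can be defined by matching on it. *)
have repP (B : {set T}) :
    {x | B \in P -> x \in B & forall z, z \in Z :&: B -> x \in Z} + (B \notin P).
  have [PB|nPB] := boolP (B \in P); [left | by right].
  have [ZB0|[z ZBz]] := set_0Vmem (Z :&: B); last first.
    by exists z => [_|_ _]; case/setIP: ZBz.
  have [B0|[x Bx]] := set_0Vmem B; first by rewrite B0 (negPf nP0) in PB.
  by exists x => // z; rewrite ZB0 inE.
pose Y := [set x | if repP (pblock P x) is inl r
                   then (x \in D) && (x == s2val r) else false].
exists Y; last first.
  apply/subsetP=> z Zz; have Dz := subsetP sZD z Zz.
  have Pz : pblock P z \in P by rewrite pblock_mem // coverP.
  rewrite inE; case: (repP _) => [[x /= Bx ZBx]|]; last by rewrite Pz.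
  (* [z] and the representative of its block both lie in [Z] and share a block, so they coincide. *)
  rewrite Dz /=; apply/eqP/injZ => //.
    by apply: (ZBx z); rewrite inE Zz mem_pblock coverP.
  by rewrite (def_pblock trivP Pz (Bx Pz)).
apply/and3P; split=> //.
  by apply/subsetP=> x; rewrite inE; case: (repP _) => // r /andP[].
apply/forall_inP=> B PB.
case rB: (repP B) => [r|nPB]; last by case/negP: (nPB).
apply/cards1P; exists (s2val r); apply/setP=> y; rewrite !inE.
have [By|nBy] := boolP (y \in B).
  rewrite (def_pblock trivP PB By) rB /= andbT.
  by rewrite -coverP; have -> : y \in cover P by apply/bigcupP; exists B.
by rewrite andbF; apply/esym/negbTE; apply: contraNneq nBy => ->; exact: (s2valP r PB).
Qed.

(** * Counting affine families whose members have distinct colours *)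

Lemma card_preim_additive (A B : finZmodType) (f : {additive A -> B}) (S : {set B}) :
  (forall y, exists x, f x = y) -> #|f @^-1: S| * #|B| = #|S| * #|A|.
Proof.
move=> surj_f.
(* Every fibre is a coset of the kernel, so taking preimages preserves density. *)
have fibre y : #|[set x | f x == y]| = #|[set x | f x == 0%R]|.
  have [x0 fx0] := surj_f y.
  rewrite -[RHS](card_imset _ (addrI x0)); apply: eq_card => x; rewrite inE.
  apply/eqP/imsetP=> [fx|[z + ->]].
    exists (x - x0)%R; last by rewrite addrC subrK.
    by rewrite inE raddfB fx fx0 subrr.
  by rewrite inE raddfD fx0 => /eqP->; rewrite addr0.
have preimE (R : {set B}) : #|f @^-1: R| = #|R| * #|[set x | f x == 0%R]|.
  rewrite -sum_nat_const -sum1_card (partition_big f (mem R)) /=; last first.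
    by move=> x; rewrite inE.
  apply: eq_bigr => y Ry; rewrite sum1dep_card -(fibre y).
  by apply: eq_card => x; rewrite !inE andb_idl // => /eqP->.
have -> : #|A| = #|f @^-1: setT| by rewrite preimsetT cardsT.
by rewrite !preimE cardsT -!mulnA; congr (_ * _); rewrite mulnC.
Qed.

(** The rows of [X] are [a] followed by those of [B], so the product is [a + y B]. A union bound
    applies: there are at most [q^(2d)] pairs, with [q = #|F|], and each gives equal colours for a
    proportion at most [K / q^n] of the matrices. *)
Lemma rainbow_affine (F : finFieldType) (d n K : nat) (C : eqType) (col : 'rV[F]_n -> C) :
    (forall u, #|[set v | col v == col u]| <= K) ->
    #|F| ^ (2 * d) * K < #|F| ^ n ->
  exists X : 'M[F]_(1 + d, n),
    injective (fun y : 'rV[F]_d => col (row_mx 1%:M y *m X)%R).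
Proof.
move=> leK ltK.
pose bad (p : 'rV[F]_d * 'rV[F]_d) := [set X : 'M[F]_(1 + d, n) |
  col (row_mx 1%:M p.1 *m X)%R == col (row_mx 1%:M p.2 *m X)%R].
pose pairs := [set p : 'rV[F]_d * 'rV[F]_d | p.1 != p.2].
have [/existsP[X /forall_inP goodX]|nogood] :=
    boolP [exists X, [forall p in pairs, X \notin bad p]].
  exists X => y y' eq_col; apply/eqP; apply: contraTT isT => neq_y.
  by have := goodX (y, y'); rewrite !inE /= eq_col eqxx neq_y => /(_ isT).
pose N := #|{: 'M[F]_(1 + d, n)}|.
have bad_le p : p \in pairs -> #|bad p| * #|F| ^ n <= K * N.
  case: p => y y'; rewrite inE /= => neq_y.
  pose f := (mulmx (col_mx (row_mx 1%:M y) (row_mx 1%:M y')) :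
    'M[F]_(1 + d, n) -> 'M[F]_(1 + 1, n)).
  pose S := [set Z : 'M[F]_(1 + 1, n) | col (usubmx Z) == col (dsubmx Z)].
  have badE : bad (y, y') = f @^-1: S.
    by apply/setP=> X; rewrite !inE /= /f mul_col_mx col_mxKu col_mxKd.
  have surj_f Z : exists X, f X = Z.
    have [i neq_i] : exists i, (y 0 i != y' 0 i)%R.
      apply/existsP; rewrite -negb_forall; apply: contra neq_y => /forallP eq_y.
      by apply/eqP/rowP=> i; apply/eqP.
    (* With [B] zero outside row [i], where it equals [r], the equations are [a + y_i r = u] and
       [a + y'_i r = w] for the rows [u], [w] of [Z]; subtracting them gives [r], then [a]. *)
    pose r := ((y 0 i - y' 0 i)^-1 *: (usubmx Z - dsubmx Z))%R.
    exists (col_mx (usubmx Z - y 0 i *: r) (delta_mx i 0 *m r))%R.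
    have entry (z : 'rV[F]_d) : (z *m (delta_mx i 0 *m r) = z 0 i *: r)%R.
      rewrite mulmxA -colE -mul_scalar_mx; congr (_ *m _)%R.
      by apply/rowP=> j; rewrite !mxE !ord1 eqxx.
    rewrite /f mul_col_mx !mul_row_col !mul1mx !entry -[RHS]vsubmxK.
    congr col_mx; first by rewrite subrK.
    rewrite -addrA [(- _ + _)%R]addrC -scalerBl -opprB scaleNr /r scalerA.
    by rewrite mulfV ?subr_eq0 // scale1r opprB addrC subrK.
  have := card_preim_additive S surj_f.
  rewrite -badE -/N card_mx mul2n -addnn expnD mulnA => cardbad.
  (* The first row is free, and the second lies in its colour class. *)
  have leS : #|S| <= #|F| ^ n * K.
    pose g (Z : 'M[F]_(1 + 1, n)) := (usubmx Z, dsubmx Z).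
    have inj_g : injective g.
      by move=> Z Z' [eu ed]; rewrite -[Z]vsubmxK eu ed vsubmxK.
    rewrite -(card_imset _ inj_g) -sum1_card.
    apply: leq_trans (_ : \sum_(u : 'rV[F]_n) \sum_(v | col v == col u) 1 <= _).
      rewrite pair_big_dep /= [leqLHS]big_mkcond [leqRHS]big_mkcond.
      apply: leq_sum => -[u v] _; case: imsetP => // -[Z]; rewrite inE => SZ [-> ->].
      by rewrite eq_sym SZ.
    rewrite -[n in _ ^ n]mul1n -card_mx -sum_nat_const; apply: leq_sum => u _.
    by rewrite sum1dep_card.
  rewrite -(leq_pmul2r (_ : 0 < #|F| ^ n)) ?expn_gt0 ?(ltnW (finNzRing_gt1 F)) //.
  by rewrite cardbad mulnAC [K * _]mulnC leq_mul2r leS orbT.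
have cover_bad : N <= \sum_(p in pairs) #|bad p|.
  apply: leq_trans (_ : #|\bigcup_(p in pairs) bad p| <= _).
    rewrite /N -cardsT; apply/subset_leq_card/subsetP=> X _.
    move: nogood; rewrite negb_exists => /forallP/(_ X).
    by case/forall_inPn=> p pp; rewrite negbK => badX; apply/bigcupP; exists p.
  elim/big_ind2: _ => [|A m B l leA leB|i _]; rewrite ?cards0 //.
  by apply: leq_trans (leq_card_setU _ _) _; apply: leq_add.
have N_gt0 : 0 < N by apply/card_gt0P; exists 0%R.
have : N * #|F| ^ n <= #|F| ^ (2 * d) * (K * N).
  apply: leq_trans (leq_mul cover_bad (leqnn _)) _; rewrite big_distrl /=.
  apply: leq_trans (_ : \sum_(p in pairs) K * N <= _); first exact: leq_sum.
  rewrite sum_nat_const leq_mul2r.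
  apply/orP; right; apply: leq_trans (max_card _) _.
  by rewrite card_prod !card_mx mul1n mul2n -addnn expnD.
by rewrite mulnC mulnA leq_pmul2r // leqNgt ltK.
Qed.

(** * The colouring number of a projective geometry and transversals of large partitions *)

Lemma PG_colouring_number_le (F : finFieldType) (n m : nat) : 0 < m ->
  m * colouring_number (PG F n) <= #|F| ^ n + m * #|F| ^ m.
Proof.
move=> m_gt0.
have [||k col_k le_k] := @greedy_colouring _ (PG F n) m (#|F| ^ m) m_gt0.
- exact: PG_loopless.
- exact: PG_indep_exists.
have [_ /(_ k col_k) le_col] := colouring_numberP col_k.
apply: leq_trans (leq_mul (leqnn m) le_col) (leq_trans le_k _).
rewrite leq_add2r; have := @card_points_subset F n (points F n) fullv (subxx _).
by rewrite dimvf /dim /= mul1n; apply=> U _; apply: memvf.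
Qed.

Lemma PG_uncolourable_transversal (F : finFieldType) (n b d m : nat)
    (P : {set {set {vspace 'rV[F]_n}}}) :
    partition P (points F n) -> 0 < m -> (forall A, A \in P -> #|A| <= m) ->
    #|F| ^ (2 * d) * (#|F| * m) < #|F| ^ n -> b * d.+1 + 1 < #|F| ^ d ->
  exists2 Y, is_transversal Y P (points F n) & ~~ set_colourable (PG F n) Y b.
Proof.
move=> partP m_gt0 le_m lt_n lt_d; have /and3P[/eqP coverP trivP nP0] := partP.
(* The default [set0] is not a block, so the zero vector is alone in its colour class. *)
pose col (v : 'rV[F]_n) := if v == 0%R then set0 else pblock P <[v]>%VS.
have colP v : v != 0%R -> (col v \in P) && (<[v]>%VS \in col v).
  move=> nz_v; rewrite /col (negPf nz_v) mem_pblock.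
  by rewrite pblock_mem coverP vline_points.
have col0 : col 0%R = set0 by rewrite /col eqxx.
have le_col u : #|[set v | col v == col u]| <= #|F| * m.
  have [->|nz_u] := eqVneq u 0%R.
    apply: leq_trans (_ : #|[set (0 : 'rV[F]_n)%R]| <= _); last first.
      by rewrite cards1 muln_gt0 m_gt0 ltnW ?finNzRing_gt1.
    apply/subset_leq_card/subsetP=> v; rewrite !inE col0 => /eqP colv.
    apply: contraNT nP0 => /colP; rewrite colv.
    by case/andP.
  have /andP[Pu _] := colP u nz_u.
  (* Vectors with the colour of [u] lie on the lines in that block, at most [m] of them with [#|F|]
     vectors each. *)
  apply: leq_trans (_ : #|\bigcup_(U in col u) [set v in U]| <= _).
    apply/subset_leq_card/subsetP=> v; rewrite inE => /eqP colv.
    have nz_v : v != 0%R.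
      by apply: contraNneq nP0 => v0; rewrite -col0 -v0 colv.
    have /andP[_ vv] := colP v nz_v; apply/bigcupP; exists <[v]>%VS.
      by rewrite -colv.
    by rewrite inE memv_line.
  apply: leq_trans (_ : \sum_(U in col u) #|F| <= _).
    apply: (@leq_trans (\sum_(U in col u) #|[set v in U]|)).
      elim/big_ind2: _ => [|A k B l leA leB|i _]; rewrite ?cards0 //.
      by apply: leq_trans (leq_card_setU _ _) _; apply: leq_add.
    apply: leq_sum => U uU; rewrite cardsE card_vspace.
    suff /[!inE] /eqP-> : U \in points F n by rewrite expn1.
    by rewrite -coverP; apply/bigcupP; exists (col u).
  by rewrite sum_nat_const mulnC leq_mul2l le_m // orbT.
have [X injX] := rainbow_affine le_col lt_n.
pose v (y : 'rV[F]_d) := (row_mx 1%:M y *m X)%R.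
pose Z := [set <[v y]>%VS | y in [set y | v y != 0%R]].
have sZE : Z \subset points F n.
  by apply/subsetP=> _ /imsetP[y + ->]; rewrite inE vline_points.
have injZ : {in Z &, injective (pblock P)}.
  move=> _ _ /imsetP[y + ->] /imsetP[y' + ->]; rewrite !inE => nz_y nz_y' eqP.
  have /injX -> // : col (v y) = col (v y').
  by rewrite /col (negPf nz_y) (negPf nz_y').
(* The colours of the [v y] are distinct, so at most one [v y] is zero; this accounts for the
   [+ 1]. *)
have cardZ : #|F| ^ d <= #|Z| + 1.
  rewrite card_in_imset; last first.
    move=> y y'; rewrite !inE => nz_y nz_y' eq_y; apply: injX.
    by rewrite -!/(v _) /col (negPf nz_y) (negPf nz_y') eq_y.
  rewrite -[d in _ ^ d]mul1n -card_mx -(cardsC [set y | v y != 0%R]) leq_add2l.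
  apply/card_le1_eqP => y y'; rewrite !inE !negbK => /eqP y0 /eqP y'0.
  by apply: injX; rewrite -!/(v _) y0 y'0.
have [Y transY sZY] := transversal_extend partP sZE injZ.
exists Y => //; apply/negP=> colY; move: lt_d; apply/negP; rewrite -leqNgt.
apply: leq_trans cardZ _; rewrite leq_add2r.
pose W := <<[seq row i X | i <- enum 'I_(1 + d)]>>%VS.
have dimW : \dim W <= d.+1.
  by apply: leq_trans (dim_span _) _; rewrite size_map size_enum_ord.
apply: leq_trans (_ : b * \dim W <= _); last by rewrite leq_mul2l dimW orbT.
apply: PG_colourable_card colY sZY sZE _ => _ /imsetP[y _ ->].
rewrite -memvE /v mulmx_sum_row; apply: memv_suml => i _; apply: memvZ.
by apply/memv_span/map_f; rewrite mem_enum.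
Qed.

Theorem theorem3 (q : nat) (hq : prime_power q) (b : nat) (hb : 1 <= b)
    (R : realType) (c : R) (hc : (1 <= c)%R) :
  exists n0 : nat, forall (F : finFieldType), #|F| = q ->
    forall n : nat, n0 <= n -> ~ has_decomposition b c (PG F n).
Proof.
pose c0 := Num.bound c.
have c_ge0 : (0 <= c)%R by apply: le_trans hc.
have lt_c := archi_boundP c_ge0; rewrite -/c0 in lt_c.
have c0_gt0 : 0 < c0 by rewrite -(ltr0n R); apply: le_lt_trans lt_c.
(* This gives [2^d = 8 * (2^b)^2 >= 8 * (b + 1)^2], which exceeds [b * (d + 1) + 1]. *)
pose d := 2 * b + 3.
have [L defL] : {L | L = q ^ (2 * d) * (q * c0)}
  by exists (q ^ (2 * d) * (q * c0)).
(* The colouring bound with [m = 2L] reads [2 L k <= q^n + 2 L q^(2L)]. As [2L < q^(2L)], the last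
   term is below [q^(4L) <= q^n], whence [L k < q^n]. *)
exists (2 * L + 2 * L) => F cardF n le_n [P [partP leP transP]].
have q_gt1 : 1 < q by rewrite -cardF finNzRing_gt1.
have L_gt0 : 0 < L by rewrite defL !muln_gt0 expn_gt0 (ltnW q_gt1) c0_gt0.
set k := colouring_number (PG F n) in leP.
have leP' A : A \in P -> #|A| <= c0 * k.
  move=> PA; rewrite -(ler_nat R) natrM; apply: le_trans (leP A PA) _.
  by rewrite ler_wpM2r ?ler0n // ltW.
(* The maximum with 1 makes the bound [c0 * maxn 1 k] on class sizes visibly positive. *)
have lt_k : L * maxn 1 k < q ^ n.
  have lt_L : 2 * L * q ^ (2 * L) < q ^ n.
    apply: leq_trans (_ : q ^ (2 * L) * q ^ (2 * L) <= _); last first.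
      by rewrite -expnD leq_pexp2l // ltnW.
    by rewrite ltn_pmul2r; [apply: ltn_expl | rewrite expn_gt0 (ltnW q_gt1)].
  rewrite maxnMr muln1 gtn_max; apply/andP; split.
    apply: leq_ltn_trans lt_L; rewrite mulnAC leq_pmull //.
    by rewrite muln_gt0 expn_gt0 (ltnW q_gt1).
  rewrite -(ltn_pmul2l (isT : 0 < 2)) mulnA.
  apply: leq_ltn_trans (PG_colouring_number_le _ _ _) _; first by rewrite muln_gt0.
  by rewrite cardF [2 * q ^ n]mul2n -addnn ltn_add2l.
have lt_d : b * d.+1 + 1 < #|F| ^ d.
  apply: leq_trans (_ : 2 ^ d <= _); last by rewrite leq_exp2r ?cardF // /d addn3.
  have lt_b := ltn_expl b (isT : 1 < 2).
  have := leq_mul lt_b lt_b; rewrite /d expnD mul2n -addnn expnD.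
  by move: (2 ^ b * 2 ^ b) => x; rewrite -[2 ^ 3]/8; lia.
have [||||Y transY /negP[]] := @PG_uncolourable_transversal F n b d (c0 * maxn 1 k) P partP.
- by rewrite muln_gt0 c0_gt0 leq_maxl.
- by move=> A /leP'/leq_trans; apply; rewrite leq_mul2l leq_maxr orbT.
- by rewrite cardF !mulnA -[_ * q * c0]mulnA -defL.
- exact: lt_d.
exact: transP.
Qed.
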